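(* Let $A$ be a Baer Jordan algebra. Then (a) $A$ has a unit element; (b) $A$ has no nilpotent elements.
   Context: Jordan algebras are over a field of characteristic different from $2$ and are not assumed unital. For a Jordan algebra $A$ put $A_+=\{a^2: a\in A\}$, $U_a b=2(ab)a-a^2b$ and $U_a(A)=\{U_ax : x\in A\}$. For a subset $S\subseteq A$ put $S^\perp=\{a\in A: U_a x=0 \text{ for all } x\in S\}$. An idempotent is an element $e$ with $e^2=e$. $A$ is called a Baer Jordan algebra if for every subset $S\subseteq A_+$ there exists an idempotent $e\in A$ such that $S^\perp=U_e(A)$. ''No nilpotent elements'' means that $0$ is the only element $a$ with $a^n=0$ for some $n\ge 1$. *)

(* Defs.v *)
From HB Require Import structures.
From mathcomp Require Import all_boot all_order all_algebra.
From mathcomp Require Import boolp classical_sets.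

Set Implicit Arguments.
Unset Strict Implicit.
Unset Printing Implicit Defensive.

Import GRing.Theory.
Local Open Scope classical_set_scope.
Local Open Scope ring_scope.

(* Jordan algebras, not assumed unital or finite-dimensional. The structure is
   declared over any field; the characteristic assumption is a hypothesis of
   the theorems. Left-linearity suffices because the product commutes. *)
HB.mixin Record Lmodule_isJordanAlgebra (K : fieldType) A
    of GRing.Lmodule K A := {
  jmul : A -> A -> A;
  jmulC : commutative jmul;
  jmulDl : left_distributive jmul +%R;
  jmulZl : forall (k : K) (a b : A), jmul (k *: a) b = k *: jmul a b;
  jmul_jordan : forall a b : A,
    jmul (jmul (jmul a a) b) a = jmul (jmul a a) (jmul b a)
}.

#[short(type="jordanAlgType")]
HB.structure Definition JordanAlgebra (K : fieldType) :=
  {A of GRing.Lmodule K A & Lmodule_isJordanAlgebra K A}.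

Declare Scope jordan_scope.
Delimit Scope jordan_scope with J.
Notation "a ∘ b" := (jmul a b) (at level 40, left associativity) : jordan_scope.
Local Open Scope jordan_scope.

Section JordanAlgebraDefs.
Variables (K : fieldType) (A : jordanAlgType K).
Implicit Types (a b e u x : A) (S : set A).

(* [jpow a n] is a^n for 1 <= n only: without a unit there is no a^0, and
   [jpow a 0] is the junk value [a]. *)
Definition jpow a (n : nat) : A := iter n.-1 (fun b => b ∘ a) a.

Definition jsquares : set A := [set a ∘ a | a in [set: A]].

Definition Uop a b : A := ((a ∘ b) ∘ a) *+ 2 - (a ∘ a) ∘ b.

Definition jperp S : set A := [set a | forall x, S x -> Uop a x = 0].

Definition jidempotent e : Prop := e ∘ e = e.

Definition junit u : Prop := forall a, u ∘ a = a /\ a ∘ u = a.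

Definition jnilpotent a : Prop := exists2 n : nat, (1 <= n)%N & jpow a n = 0.

End JordanAlgebraDefs.

Definition baer_jordan (K : fieldType) (A : jordanAlgType K) : Prop :=
  forall S : set A, S `<=` @jsquares K A ->
    exists2 e : A, jidempotent e & jperp S = range (Uop e).

(* Main.v *)
(** Applied to the empty set, the Baer condition gives an idempotent e with
    U_e(A) = A; since e U_e = U_e, this e is a unit element 1. As U_a 1 = a^2,
    the set {1}^perp consists of the elements of square zero. It equals U_f(A)
    for an idempotent f, and contains f = U_f f, so f = f^2 = 0: square-zero
    elements vanish. By power associativity a^(n+1) = 0 implies
    (a^n)^2 = 0 for n >= 1, so every nilpotent element is zero. *)
Require Import Defs.
From HB Require Import structures.
From mathcomp Require Import all_boot all_order all_algebra.
From mathcomp Require Import boolp classical_sets.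

Import GRing.Theory.
Local Open Scope ring_scope.
Local Open Scope jordan_scope.

Section JordanTheory.
Context {K : fieldType} {A : jordanAlgType K}.
Implicit Types (a b c d e x y : A) (n m : nat).

Lemma jmulDr a b c : a ∘ (b + c) = a ∘ b + a ∘ c.
Proof. by rewrite jmulC jmulDl !(jmulC a). Qed.

Lemma jmulNl a b : (- a) ∘ b = - (a ∘ b).
Proof. by rewrite -scaleN1r jmulZl scaleN1r. Qed.

Lemma jmulNr a b : a ∘ (- b) = - (a ∘ b).
Proof. by rewrite jmulC jmulNl jmulC. Qed.

Lemma jmul0l a : 0 ∘ a = 0.
Proof. by rewrite -(scale0r (0 : A)) jmulZl !scale0r. Qed.

(** The associator of [x ∘ y], [b] and [z]: trilinear in [x], [y], [z], and zero on the diagonal by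
    the Jordan identity, hence ready for polarization. *)
Definition jdefect b x y z : A := ((x ∘ y) ∘ b) ∘ z - (x ∘ y) ∘ (b ∘ z).

Lemma jdefect_diag b x : jdefect b x x x = 0.
Proof. by rewrite /jdefect jmul_jordan subrr. Qed.

Lemma jdefectC b x y z : jdefect b x y z = jdefect b y x z.
Proof. by rewrite /jdefect (jmulC x y). Qed.

Lemma jdefectDl b x x' y z :
  jdefect b (x + x') y z = jdefect b x y z + jdefect b x' y z.
Proof. by rewrite /jdefect !jmulDl opprD addrACA. Qed.

Lemma jdefectDm b x y y' z :
  jdefect b x (y + y') z = jdefect b x y z + jdefect b x y' z.
Proof. by rewrite jdefectC jdefectDl !(jdefectC b x). Qed.

Lemma jdefectDr b x y z z' :
  jdefect b x y (z + z') = jdefect b x y z + jdefect b x y z'.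
Proof. by rewrite /jdefect !jmulDr opprD addrACA. Qed.

Lemma jdefectNl b x y z : jdefect b (- x) y z = - jdefect b x y z.
Proof. by rewrite /jdefect !jmulNl opprB opprK addrC. Qed.

Lemma jdefectNm b x y z : jdefect b x (- y) z = - jdefect b x y z.
Proof. by rewrite jdefectC jdefectNl jdefectC. Qed.

Lemma jdefectNr b x y z : jdefect b x y (- z) = - jdefect b x y z.
Proof. by rewrite /jdefect !jmulNr opprB opprK addrC. Qed.

Lemma jdefect_add b x y :
  (jdefect b x x y + jdefect b x y x *+ 2)
  + (jdefect b y y x + jdefect b y x y *+ 2) = 0.
Proof.
have := jdefect_diag b (x + y).
rewrite !(jdefectDl, jdefectDm, jdefectDr) !jdefect_diag add0r addr0.
rewrite (jdefectC b y x x) (jdefectC b x y y) !mulr2n => <-.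
by rewrite [RHS](AC (1*2*3) (1*(2*4)*(6*(3*5)))) /=.
Qed.

Section CharNot2.
Hypothesis charK : 2%N \notin [pchar K].

Lemma mulr2n_eq0_pchar x : x *+ 2 = 0 -> x = 0.
Proof.
move/eqP; rewrite -scaler_nat scaler_eq0; case/orP=> [two0|/eqP //].
by move: charK; rewrite inE /= two0.
Qed.

(** In [jdefect_add] the first bracket is odd in [y] and the second even, so comparing [y] with
    [- y] isolates twice the first. Only the scalar 2 is cancelled, so small fields and
    characteristic 3 are covered. *)
Lemma jdefect_lin1 b x y : jdefect b x x y + jdefect b x y x *+ 2 = 0.
Proof.
apply: mulr2n_eq0_pchar.
have := jdefect_add b x y; have := jdefect_add b x (- y).
rewrite !(jdefectNl, jdefectNm, jdefectNr) !opprK.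
set P := jdefect b x x y + _; set Q := jdefect b y y x + _.
rewrite mulNrn -opprD -/P -/Q addrC => /subr0_eq ->.
by rewrite mulr2n.
Qed.

Lemma jdefect_lin b x y z :
  jdefect b x y z + jdefect b y z x + jdefect b z x y = 0.
Proof.
apply: mulr2n_eq0_pchar.
(* Polarize in the repeated variable: the cross terms add up to twice the cyclic sum. *)
have := jdefect_lin1 b (x + y) z.
have := jdefect_lin1 b x z; have := jdefect_lin1 b y z.
rewrite !(jdefectDl, jdefectDm, jdefectDr).
rewrite (jdefectC b y x z) (jdefectC b x z y) => Hy Hx.
move: (jdefect b x x z) Hx => p /eqP; rewrite addr_eq0 => /eqP ->.
move: (jdefect b y y z) Hy => q /eqP; rewrite addr_eq0 => /eqP ->.
move: (jdefect b x y z) (jdefect b y z x) (jdefect b z x y) => t u v.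
move: (jdefect b x z x) (jdefect b y z y) => r s <-.
rewrite !mulrnDl.
rewrite [RHS](AC ((2*2)*(2*2)) ((2*3)*7*6*((1*5)*(4*8)))) /=.
by rewrite !addNr !addr0 mulr2n.
Qed.

(** The fully linearized Jordan identity, read as a formula for the
    multiplication operator of (ac)b applied to d. *)
Lemma jmul_operator a b c d :
  ((a ∘ c) ∘ b) ∘ d =
  (a ∘ c) ∘ (b ∘ d) + (b ∘ a) ∘ (c ∘ d) + (b ∘ c) ∘ (a ∘ d)
  - a ∘ (b ∘ (c ∘ d)) - c ∘ (b ∘ (a ∘ d)).
Proof.
have := jdefect_lin b a c d; rewrite /jdefect.
rewrite (jmulC d a) (jmulC (c ∘ d) b) (jmulC (a ∘ d) b).
rewrite (jmulC (b ∘ (c ∘ d))) (jmulC (b ∘ (a ∘ d))).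
rewrite (jmulC (c ∘ d)) (jmulC (a ∘ d)).
rewrite -!addrA => /eqP; rewrite addr_eq0 => /eqP ->.
rewrite !opprD !opprK.
by rewrite !addrA [RHS](ACl (1*4*2*5*3)).
Qed.

Lemma jpowS a n : jpow a n.+2 = jpow a n.+1 ∘ a.
Proof. by []. Qed.

Lemma jpow_comm a n x :
  jpow a n.+1 ∘ (a ∘ x) = a ∘ (jpow a n.+1 ∘ x).
Proof.
have comm2 y : (a ∘ a) ∘ (a ∘ y) = a ∘ ((a ∘ a) ∘ y).
  by rewrite (jmulC a y) -jmul_jordan jmulC.
(* The recursion for powers reaches back two exponents, so the induction carries two consecutive
   ones. *)
suff /(_ n)[] : forall k,
  (forall y, jpow a k.+1 ∘ (a ∘ y) = a ∘ (jpow a k.+1 ∘ y)) /\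
  (forall y, jpow a k.+2 ∘ (a ∘ y) = a ∘ (jpow a k.+2 ∘ y)) by [].
elim=> [|k [IH1 IH2]]; first by split.
split=> // y.
(* [jmul_operator] writes multiplication by a^(k+3) in terms of
   multiplications by a, a^2, a^(k+1) and a^(k+2). *)
rewrite (jpowS a k.+1) {1 2}(jpowS a k) !jmul_operator.
rewrite (jmulC a (jpow a k.+1)) -jpowS !jmulDr !jmulNr.
by rewrite !IH1 !IH2 !comm2.
Qed.

Lemma jpowD a m n : jpow a m.+1 ∘ jpow a n.+1 = jpow a (m + n).+2.
Proof.
elim: n => [|n IH]; first by rewrite addn0.
by rewrite jpowS (jmulC _ a) jpow_comm IH addnS [RHS]jpowS jmulC.
Qed.

Lemma jnilpotent_eq0 a :
  (forall b, b ∘ b = 0 -> b = 0) -> jnilpotent a -> a = 0.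
Proof.
move=> sq0 [[//|n] _]; elim: n => [//|n IH] an0.
(* Here a^(n+2) = 0, and the square of a^(n+1) is a^(2n+2), a power at least as high. *)
apply/IH/sq0; rewrite jpowD.
have: forall k, jpow a (k + n).+2 = 0; last exact.
by elim=> [|k IHk] //; rewrite addSn jpowS IHk jmul0l.
Qed.

(** With L the multiplication by [e], [jmul_operator] at [e], [e], [e] is the Peirce relation 2L^3 -
    3L^2 + L = 0. Since U_e = 2L^2 - L, it says (L - 1)U_e = 0. *)
Lemma jmul_idem_Uop e x : jidempotent e -> e ∘ Uop e x = Uop e x.
Proof.
move=> ee; rewrite /Uop ee mulr2n !jmulDr jmulNr (jmulC (e ∘ x) e).
have := jmul_operator e e e x; rewrite !ee.
set p := e ∘ x; set q := e ∘ p; set r := e ∘ q => {1}->.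
by rewrite !opprB !opprD !addrA [RHS](ACl (3*4*5*1*6*2*7)) /= !subrK.
Qed.

Lemma Uop_idem e : jidempotent e -> Uop e e = e.
Proof. by move=> ee; rewrite /Uop !ee mulr2n addrK. Qed.

Lemma Uop_unit u a : junit u -> Uop a u = a ∘ a.
Proof.
by move=> unit_u; rewrite /Uop !(proj2 (unit_u _)) mulr2n addrK.
Qed.

Lemma baer_junit : baer_jordan A -> exists u : A, junit u.
Proof.
case/(_ set0 (@sub0set _ _)) => e ee perp0; exists e => a.
have [x _ <-] : range (Uop e) a by rewrite -perp0.
by rewrite (jmulC _ e) jmul_idem_Uop.
Qed.

Lemma baer_square_eq0 b : baer_jordan A -> b ∘ b = 0 -> b = 0.
Proof.
move=> baerA bb0; have [u unit_u] := baer_junit baerA.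
have [|f ff perp1] := baerA [set u]%classic.
  (* The unit is its own square, so the Baer condition applies to its singleton. *)
  by move=> _ ->; exists u => //; case: (unit_u u).
have sq0 c : range (Uop f) c <-> c ∘ c = 0.
  rewrite -perp1 -(Uop_unit u c unit_u); split=> [|c0 _ -> //]; exact.
have f0 : f = 0.
  by rewrite -ff; apply/sq0; exists f => //; apply: Uop_idem.
by have /sq0[x _ <-] := bb0; rewrite f0 /Uop !jmul0l mul0rn subrr.
Qed.

End CharNot2.
End JordanTheory.

Theorem lemma2p4 (K : fieldType) (charK : 2%N \notin [pchar K])
    (A : jordanAlgType K) (baerA : baer_jordan A) :
  (exists u : A, junit u) /\ (forall a : A, jnilpotent a <-> a = 0).
Proof.
split=> [|a]; first exact: baer_junit.
split=> [|->]; last by exists 1%N.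
by apply: jnilpotent_eq0 => // b; apply: baer_square_eq0.
Qed.
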